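(* Let $c>0$ be an integer, let $T^c$ be the initial non-one $c$-grid, and let $T^{c,i}$, $1\le i\le c$, be its row reductions. (i) For $1\le i\le c$, $t(c,i)=\frac1i\,t(c,1)$, with $t(c,1)=\frac{c}{2c+1}$. (ii) For $1\le i\le c$, the four edge-ratio relationships hold in the $i$-grid $T^{c,i}$. (iii) For $1\le i\le c-1$, $$T^{c,i}_{X,r,d}=f(c,i)\,T^{i}_{X,r,d}\qquad\text{for all } 1\le r\le i,\ 1\le d\le r,\ X\in\{L,R,B\}.$$
   Context: **Labelled grids.** For $n\ge 1$, an $n$-grid is the triangular graph made of $n$ rows of upright triangles: row $r$ ($1\le r\le n$, counted from the top) contains the upright triangles $T_{r,d}$, $1\le d\le r$, counted from the left. The edges of the graph are exactly the left, right and base edges of the upright triangles, and each edge belongs to exactly one upright triangle. A labelled $n$-grid $T$ is an assignment of positive real labels (resistances) $T_{L,r,d},T_{R,r,d},T_{B,r,d}$ to the left, right and base edges of each $T_{r,d}$, $1\le d\le r\le n$. **Edge-ratio functions.** $$r_{R,L}(r,d)=\frac{2(r-d)+1}{2d-1},\qquad r_{B,L}(n,r,d)=\frac{2(n-r)+1}{2d-1},$$ $$x(n,r)=\frac{r-1}{2r-1}\cdot\frac{2(n-r)+3}{(n-r)+1},\qquad y(r,d)=\frac{d-1}{2d-3}\cdot\frac{2(r-d)+3}{(r-d)+1}.$$ **The four edge-ratio relationships** for a labelled $n$-grid $T$ are: $T_{L,r,1}=x(n,r)\,T_{L,r-1,1}$ for $2\le r\le n$; $T_{L,r,d}=y(r,d)\,T_{L,r,d-1}$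 for $2\le d\le r\le n$; $T_{R,r,d}=r_{R,L}(r,d)\,T_{L,r,d}$ for $1\le d\le r\le n$; $T_{B,r,d}=r_{B,L}(n,r,d)\,T_{L,r,d}$ for $1\le d\le r\le n$. **Initial non-one grid.** For $m\ge1$, $T^{m}$ is the labelled $m$-grid determined by $T^m_{L,1,1}=1$ and the four edge-ratio relationships with $n=m$. **Row reduction.** Let $\Delta(u,v,w)=\frac{uv}{u+v+w}$ and $Y(u,v,w)=\frac{uv+vw+wu}{u}$. Given a labelled $n$-grid $T$ (the parent), apply the $\Delta$–Y transformation to each upright triangle, giving legs $$Y_{12,r,d}=\Delta(T_{L,r,d},T_{R,r,d},T_{B,r,d}),\quad Y_{4,r,d}=\Delta(T_{R,r,d},T_{B,r,d},T_{L,r,d}),\quad Y_{8,r,d}=\Delta(T_{B,r,d},T_{L,r,d},T_{R,r,d})$$ (from the center of the triangle to its top, lower right, lower left vertex respectively). The corner tails are $Y_{12,1,1},Y_{8,n,1},Y_{4,n,n}$. If $n\ge 2$, discard the corner tails, combine consecutive boundary legs in series, and apply the Y–$\Delta$ transformation to the remaining stars. The result is the row-reduced (child) labelled $(n-1)$-grid $T'$ with, explicitly: - $T'_{L,r,1}=Y_{8,r,1}+Y_{12,r+1,1}$ for $1\le r\le n-1$; - $T'_{R,r,r}=Y_{4,r,r}+Y_{12,r+1,r+1}$ for $1\le r\le n-1$; - $T'_{B,n-1,d}=Y_{4,n,d}+Y_{8,n,d+1}$ for $1\le d\le n-1$; - $T'_{L,r,d}=Y(Y_{4,r,d-1},Y_{8,r,d},Y_{12,r+1,d})$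 for $2\le d\le r\le n-1$; - $T'_{R,r,d}=Y(Y_{8,r,d+1},Y_{4,r,d},Y_{12,r+1,d+1})$ for $1\le d\le r-1$, $r\le n-1$; - $T'_{B,r,d}=Y(Y_{12,r+2,d+1},Y_{4,r+1,d},Y_{8,r+1,d+1})$ for $1\le d\le r\le n-2$. For $1\le i\le c$, $T^{c,i}$ is the labelled $i$-grid obtained from $T^c$ by $c-i$ consecutive row reductions (so $T^{c,c}=T^c$). **Tails.** $t(c,i)$ is the label of any corner tail arising when the $\Delta$–Y transformations are applied to $T^{c,i}$ (the three corner tails have equal labels); that is, $t(c,i)=\Delta\big(T^{c,i}_{L,1,1},T^{c,i}_{R,1,1},T^{c,i}_{B,1,1}\big)$. **The function $f$.** $f(c,i)=1+\frac{c-i}{i}\cdot\frac{1}{2c+1}$ for $1\le i\le c-1$. *)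

(* Defs.v *)
From HB Require Import structures.
From mathcomp Require Import all_boot all_order all_algebra reals.
From mathcomp Require Import zify lra.

Set Implicit Arguments.
Unset Strict Implicit.
Unset Printing Implicit Defensive.

Import Order.TTheory GRing.Theory Num.Theory.
Local Open Scope ring_scope.

Inductive side := Left | Right | Base.

(* Triangles carry one-based indices (r, d) with 1 <= d <= r <= order; the
   values of label outside that range are junk and the labels inside the range
   never depend on them.  Order 0 (the empty grid) is allowed only to keep the
   operations total. *)
Record labelled_grid (R : realType) := LabelledGrid {
  order : nat;
  label :> side -> nat -> nat -> R;
  label_gt0 : forall X r d,
    (1 <= d <= r)%N -> (r <= order)%N -> 0 < label X r d
}.

Section EdgeRatios.
Variable R : realType.
Implicit Types n r d : nat.

Definition ratio_RL r d : R := (2 * (r%:R - d%:R) + 1) / (2 * d%:R - 1).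

Definition ratio_BL n r d : R := (2 * (n%:R - r%:R) + 1) / (2 * d%:R - 1).

Definition ratio_x n r : R :=
  (r%:R - 1) / (2 * r%:R - 1)
  * ((2 * (n%:R - r%:R) + 3) / ((n%:R - r%:R) + 1)).

Definition ratio_y r d : R :=
  (d%:R - 1) / (2 * d%:R - 3)
  * ((2 * (r%:R - d%:R) + 3) / ((r%:R - d%:R) + 1)).

Definition edge_ratio_relationships (T : labelled_grid R) : Prop :=
  [/\ forall r, (2 <= r <= order T)%N ->
        T Left r 1%N = ratio_x (order T) r * T Left r.-1 1%N,
      forall r d, (2 <= d <= r)%N -> (r <= order T)%N ->
        T Left r d = ratio_y r d * T Left r d.-1,
      forall r d, (1 <= d <= r)%N -> (r <= order T)%N ->
        T Right r d = ratio_RL r d * T Left r d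
    & forall r d, (1 <= d <= r)%N -> (r <= order T)%N ->
        T Base r d = ratio_BL (order T) r d * T Left r d].

Lemma ratio_RL_gt0 r d : (1 <= d <= r)%N -> 0 < ratio_RL r d.
Proof.
case/andP; rewrite -(ler_nat R) -(ler_nat R d) => d1 dr.
by rewrite divr_gt0 //; lra.
Qed.

Lemma ratio_BL_gt0 n r d : (1 <= d)%N -> (r <= n)%N -> 0 < ratio_BL n r d.
Proof.
rewrite -(ler_nat R) -(ler_nat R r) => d1 rn.
by rewrite divr_gt0 //; lra.
Qed.

Lemma ratio_x_gt0 n r : (2 <= r <= n)%N -> 0 < ratio_x n r.
Proof.
case/andP; rewrite -(ler_nat R) -(ler_nat R r) => r2 rn.
by rewrite mulr_gt0 // divr_gt0 //; lra.
Qed.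

Lemma ratio_y_gt0 r d : (2 <= d <= r)%N -> 0 < ratio_y r d.
Proof.
case/andP; rewrite -(ler_nat R) -(ler_nat R d) => d2 dr.
by rewrite mulr_gt0 // divr_gt0 //; lra.
Qed.

(* The relationships and the label 1 at (Left, 1, 1) leave no choice: go down
   the left boundary to row r, then right along row r. *)
Definition initial_left m r d : R :=
  \prod_(2 <= k < r.+1) ratio_x m k * \prod_(2 <= k < d.+1) ratio_y r k.

Definition initial_label m (X : side) r d : R :=
  match X with
  | Left => initial_left m r d
  | Right => ratio_RL r d * initial_left m r d
  | Base => ratio_BL m r d * initial_left m r d
  end.

Lemma initial_label_gt0 m X r d :
  (1 <= d <= r)%N -> (r <= m)%N -> 0 < initial_label m X r d.
Proof.
move=> dr rm; have L0 : 0 < initial_left m r d.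
  rewrite mulr_gt0 // big_nat_cond prodr_gt0 // => k; rewrite andbT => kP.
    by apply: ratio_x_gt0; lia.
  by apply: ratio_y_gt0; lia.
case: X => //=; rewrite mulr_gt0 ?ratio_RL_gt0 // ratio_BL_gt0 //.
by case/andP: dr.
Qed.

Definition initial_grid m : labelled_grid R :=
  LabelledGrid (@initial_label_gt0 m).

Lemma initial_gridP m :
  initial_grid m Left 1%N 1%N = 1 /\ edge_ratio_relationships (initial_grid m).
Proof.
split; first by rewrite /= /initial_left !big_geq // mulr1.
split=> //= [[//|r] /andP[r2 _]|r [//|d] /andP[d2 _] _]; rewrite /initial_left /=.
  by rewrite !(big_geq (m := 2) (n := 2)) // !mulr1 big_nat_recr 1?mulrC.
by rewrite [X in _ * X = _]big_nat_recr //= mulrA [LHS]mulrC.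
Qed.

Lemma initial_grid_unique m (T : labelled_grid R) :
    order T = m -> T Left 1%N 1%N = 1 -> edge_ratio_relationships T ->
  forall X r d, (1 <= d <= r)%N -> (r <= m)%N -> T X r d = initial_grid m X r d.
Proof.
move=> Tm T1 []; rewrite Tm => Tx Ty TR TB.
have [I1 [/= Ix Iy _ _]] := initial_gridP m.
have E1 r : (1 <= r <= m)%N -> T Left r 1%N = initial_left m r 1.
  elim: r => [|[|r] IH] // rm; first by rewrite T1 -I1.
  by rewrite Tx // Ix //= IH //; lia.
have EL r d : (1 <= d <= r)%N -> (r <= m)%N -> T Left r d = initial_left m r d.
  elim: d => [|[|d] IH] // dr rm; first by rewrite E1 //; lia.
  by rewrite Ty // Iy //= IH //; lia.
by move=> [] r d dr rm /=; rewrite ?TR ?TB // EL.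
Qed.

End EdgeRatios.

Section RowReduction.
Variable R : realType.
Implicit Type T : labelled_grid R.

Definition Delta (u v w : R) : R := u * v / (u + v + w).

Definition Ystar (u v w : R) : R := (u * v + v * w + w * u) / u.

(* Legs from the center of the triangle to its top (12 o'clock), lower right
   (4 o'clock) and lower left (8 o'clock) vertices. *)
Definition Y12 T r d : R := Delta (T Left r d) (T Right r d) (T Base r d).
Definition Y4 T r d : R := Delta (T Right r d) (T Base r d) (T Left r d).
Definition Y8 T r d : R := Delta (T Base r d) (T Left r d) (T Right r d).

Definition row_reduced_label T (X : side) (r d : nat) : R :=
  match X with
  | Left =>
      if d == 1%N then Y8 T r 1 + Y12 T r.+1 1
      else Ystar (Y4 T r d.-1) (Y8 T r d) (Y12 T r.+1 d)
  | Right =>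
      if d == r then Y4 T r r + Y12 T r.+1 r.+1
      else Ystar (Y8 T r d.+1) (Y4 T r d) (Y12 T r.+1 d.+1)
  | Base =>
      if r == (order T).-1 then Y4 T (order T) d + Y8 T (order T) d.+1
      else Ystar (Y12 T r.+2 d.+1) (Y4 T r.+1 d) (Y8 T r.+1 d.+1)
  end.

Lemma Delta_gt0 u v w : 0 < u -> 0 < v -> 0 < w -> 0 < Delta u v w.
Proof. by move=> *; rewrite divr_gt0 ?mulr_gt0 ?addr_gt0. Qed.

Lemma Ystar_gt0 u v w : 0 < u -> 0 < v -> 0 < w -> 0 < Ystar u v w.
Proof. by move=> *; rewrite divr_gt0 ?addr_gt0 ?mulr_gt0. Qed.

Lemma row_reduced_label_gt0 T X r d :
  (1 <= d <= r)%N -> (r <= (order T).-1)%N -> 0 < row_reduced_label T X r d.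
Proof.
move=> dr rn.
by case: X => /=; case: eqP => e; rewrite ?addr_gt0 ?Ystar_gt0 //;
  apply: Delta_gt0; apply: label_gt0; lia.
Qed.

Definition row_reduction T : labelled_grid R :=
  LabelledGrid (@row_reduced_label_gt0 T).

End RowReduction.

(* An i-grid for 1 <= i <= c, by order_reduced_grid below. *)
Definition reduced_grid (R : realType) (c i : nat) : labelled_grid R :=
  iter (c - i) (@row_reduction R) (initial_grid R c).

Lemma order_reduced_grid (R : realType) c i :
  (i <= c)%N -> order (reduced_grid R c i) = i.
Proof.
move=> ic; rewrite /reduced_grid -[RHS](subKn ic).
by elim: (c - i)%N => [|k IH] /=; rewrite ?subn0 // IH subnS.
Qed.

(* The top corner tail; on these grids the three corner tails have equal labels. *)
Definition tail (R : realType) (c i : nat) : R := Y12 (reduced_grid R c i) 1 1.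

Definition scale_f (R : realType) (c i : nat) : R :=
  1 + (c%:R - i%:R) / i%:R * (1 / (2 * c%:R + 1)).

(* Main.v *)
Require Import Defs.
From mathcomp Require Import all_boot all_order all_algebra reals.
From mathcomp Require Import zify ring lra.

Import Order.TTheory GRing.Theory Num.Theory.
Local Open Scope ring_scope.

(** In the barycentric coordinates i = d - 1, j = r - d, k = n - r of an upright
triangle, i + j + k = n - 1, the initial n-grid is symmetric: its left, right
and base labels are (2i+1) u, (2j+1) u and (2k+1) u, where
u = W(i) W(j) W(k) / W(n-1) and W(m) = m! / (3 * 5 * ... * (2m+1)).  Since the
three labels of a triangle sum to (2n+1) u, the legs of its star are explicit,
and each Y-Delta or series combination gives back, by (2m+3) W(m+1) = (m+1) W(m),
a multiple of the label of the initial (n-1)-grid by the constant g(n-1) / g(n),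
where g(m) = (2m+1) / m.  Row reduction is homogeneous, so these constants
telescope to f(c, i) = g(i) / g(c). *)

Section Barycentric.
Variable R : realType.
Implicit Types (s : R) (i j k n r d : nat) (T : labelled_grid R).

(** * The initial grid in barycentric coordinates *)

Definition odd_ratio n : R := \prod_(m < n) (m.+1%:R / (2 * m%:R + 3)).

Definition weight i j k : R :=
  odd_ratio i * odd_ratio j * odd_ratio k / odd_ratio (i + j + k).

Lemma odd_ratio0 : odd_ratio 0 = 1.
Proof. by rewrite /odd_ratio big_ord0. Qed.

Lemma odd_ratioS n :
  odd_ratio n.+1 = odd_ratio n * ((n%:R + 1) / (2 * n%:R + 3)).
Proof. by rewrite /odd_ratio big_ord_recr /= -(natr1 n). Qed.

Lemma odd_ratio_gt0 n : 0 < odd_ratio n.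
Proof.
apply: prodr_gt0 => m _; rewrite divr_gt0 //.
by have := ler0n R m; lra.
Qed.

Lemma odd_ratio_neq0 n : odd_ratio n != 0.
Proof. by rewrite gt_eqF ?odd_ratio_gt0. Qed.

Lemma weight0 k : weight 0 0 k = 1.
Proof. by rewrite /weight odd_ratio0 !mul1r divff ?odd_ratio_neq0. Qed.

Lemma weight_gt0 i j k : 0 < weight i j k.
Proof. by rewrite divr_gt0 ?mulr_gt0 ?odd_ratio_gt0. Qed.

(** Both sides obey the same recursion. For i = 0 the induction on j descends the left boundary by
    [ratio_x]; a step of [ratio_y] along a row trades one unit of j for one of i. *)
Lemma initial_left_weight i j k :
  initial_left R (i + j + k).+1 (i + j).+1 i.+1
  = (2 * i%:R + 1) * weight i j k.
Proof.
have [T1 [/= Tx Ty _ _]] := initial_gridP R (i + j + k).+1.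
elim: i j Tx Ty T1 => [|i IH] j Tx Ty /= T1.
  elim: j k Tx {Ty} T1 => [|j IH] k Tx T1; first by rewrite weight0 T1; ring.
  rewrite Tx ?[(_.+1).-1]/=; last by lia.
  rewrite !add0n addSnnS in IH *; rewrite IH ?add0n -?addSnnS //.
  rewrite /weight /ratio_x !add0n addSnnS !odd_ratioS -addSnnS odd_ratio0.
  have := odd_ratio_neq0 (j.+1 + k).
  rewrite ?natrD -?(natr1 i) -?(natr1 j) -?(natr1 k).
  have := ler0n R j; have := ler0n R k => k0 j0 W0.
  by field; rewrite W0 !gt_eqF //; lra.
rewrite Ty /=; [|lia|lia].
have e : (i.+1 + j = i + j.+1)%N by lia.
rewrite e in Tx Ty T1 *; rewrite IH //.
rewrite /weight /ratio_y e !odd_ratioS.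
have W0 := odd_ratio_neq0 (i + j.+1 + k).
rewrite ?natrD -?(natr1 i) -?(natr1 j) -?(natr1 k).
have := ler0n R i; have := ler0n R j => j0 i0.
by field; rewrite W0 !gt_eqF //; lra.
Qed.

Lemma initial_label_weight i j k X :
  initial_label R (i + j + k).+1 X (i + j).+1 i.+1
  = weight i j k * match X with
    | Left => 2 * i%:R + 1
    | Right => 2 * j%:R + 1
    | Base => 2 * k%:R + 1
    end.
Proof.
have i0 := ler0n R i.
case: X; rewrite /= initial_left_weight /ratio_RL /ratio_BL; last 2 first.
- by field; rewrite gt_eqF //; lra.
- by field; rewrite gt_eqF //; lra.
by ring.
Qed.

(** * Star legs of a multiple of the initial grid *)

Definition homothetic s n T : Prop :=
  Defs.order T = n /\
  forall X r d, (1 <= d <= r)%N -> (r <= n)%N ->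
    T X r d = s * initial_label R n X r d.

Lemma homothetic_label s T i j k X : homothetic s (i + j + k).+1 T ->
  T X (i + j).+1 i.+1 = s * initial_label R (i + j + k).+1 X (i + j).+1 i.+1.
Proof. by case=> _ -> //; lia. Qed.

(* The leg toward the vertex shared by the sides of coordinates i and j, in the
   triangle whose third coordinate is k. *)
Definition leg s i j k : R :=
  (2 * i%:R + 1) * (2 * j%:R + 1) * (s * weight i j k)
  / (2 * (i%:R + j%:R + k%:R) + 3).

Lemma legC s i j k : leg s i j k = leg s j i k.
Proof.
by rewrite /leg /weight (addnC j); congr (_ / _); ring.
Qed.

Lemma weight_rot i j k : weight i j k = weight j k i.
Proof. by rewrite /weight -addnA (addnC i); congr (_ / _); ring. Qed.

Lemma Delta_scale (t u v w : R) : t != 0 ->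
  Delta (t * u) (t * v) (t * w) = u * v * t / (u + v + w).
Proof.
(* Abstracting the inverse spares the condition that u + v + w be nonzero. *)
by move=> t0; rewrite /Delta -!mulrDr invfM; move: (u + v + w)^-1 => z; field.
Qed.

(** The three labels share the factor s times the weight, and their odd factors sum to 2(i + j + k)
    + 3, the denominator of [leg]. *)
Lemma legsE s T i j k : 0 < s -> homothetic s (i + j + k).+1 T ->
  [/\ Y12 T (i + j).+1 i.+1 = leg s i j k,
      Y4 T (i + j).+1 i.+1 = leg s j k i
    & Y8 T (i + j).+1 i.+1 = leg s k i j].
Proof.
move=> s0 hT; rewrite /Y12 /Y4 /Y8 /leg (weight_rot k i j) -(weight_rot i j k).
rewrite !(homothetic_label _ _ _ _ _ _ hT) !initial_label_weight.
move: (weight i j k) (weight_gt0 i j k) => p p0; rewrite !(mulrA s).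
have t0 : s * p != 0 by rewrite gt_eqF ?mulr_gt0.
by rewrite !Delta_scale //; split; congr (_ / _); ring.
Qed.

(** * One row reduction: parent legs against child labels *)

Lemma scale_f_succ n : (0 < n)%N ->
  scale_f R n.+1 n = (n%:R + 1) * (2 * n%:R + 1) / (n%:R * (2 * n%:R + 3)).
Proof.
rewrite /scale_f -(ltr_nat R) -(natr1 n) => n0.
by field; rewrite !gt_eqF //; lra.
Qed.

(** By [scale_raise_coef], this is the scaled weight of the child triangle (i, j, k) divided by i +
    j + k + 2; it serves as the unit for the legs that form the child. *)
Definition raise_coef s i j k : R :=
  s * weight i j k * (2 * (i%:R + j%:R + k%:R) + 3)
  / ((i%:R + j%:R + k%:R + 1) * (2 * (i%:R + j%:R + k%:R) + 5)).

(** The recursion of W turns the factor 2k + 3 of the raised coordinate into k + 1. *)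
Lemma leg_raise s i j k :
  leg s k.+1 i j = (2 * i%:R + 1) * (k%:R + 1) * raise_coef s i j k.
Proof.
rewrite /leg /raise_coef (weight_rot k.+1) /weight addnS !odd_ratioS !natrD.
have := ler0n R i; have := ler0n R j; have := ler0n R k.
rewrite -(natr1 k); move: i%:R j%:R k%:R (odd_ratio_neq0 (i + j + k)).
move=> x y z W0 z0 y0 x0.
by field; rewrite W0 !gt_eqF //; lra.
Qed.

Lemma raise_coefC s i j k : raise_coef s i j k = raise_coef s i k j.
Proof.
rewrite /raise_coef /weight -addrA (addrC j%:R) addrA.
by rewrite -addnA (addnC j) addnA (mulrAC _ (odd_ratio j)).
Qed.

Lemma leg_raise2 s i j k :
  leg s j.+1 k.+1 i
  = (2 * i%:R + 3) * (j%:R + 1) * (k%:R + 1) / (i%:R + 1)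
    * raise_coef s i.+1 j k.
Proof.
rewrite /leg /raise_coef -(weight_rot i) /weight !(addnS, addSn) !odd_ratioS.
rewrite -(natr1 (i + j + k)) !natrD.
have := ler0n R i; have := ler0n R j; have := ler0n R k.
rewrite -(natr1 i) -(natr1 j) -(natr1 k).
move: i%:R j%:R k%:R (odd_ratio_neq0 (i + j + k)) => x y z W0 z0 y0 x0.
by field; rewrite W0 !gt_eqF //; lra.
Qed.

Lemma scale_raise_coef s i j k :
  s * scale_f R (i + j + k).+2 (i + j + k).+1 * weight i j k
  = (i%:R + j%:R + k%:R + 2) * raise_coef s i j k.
Proof.
rewrite /raise_coef scale_f_succ // -(natr1 (i + j + k)) !natrD.
have := ler0n R i; have := ler0n R j; have := ler0n R k.
move: (weight i j k) i%:R j%:R k%:R => p x y z z0 y0 x0.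
by field; rewrite !gt_eqF //; lra.
Qed.

Lemma raise_coef_gt0 s i j k : 0 < s -> 0 < raise_coef s i j k.
Proof.
move=> s0; have := ler0n R i; have := ler0n R j; have := ler0n R k.
move=> k0 j0 i0; apply: divr_gt0; last by apply: mulr_gt0; lra.
by apply: mulr_gt0; [exact: mulr_gt0 (weight_gt0 i j k) | lra].
Qed.

Lemma scale_f_gt0 c i : (i <= c)%N -> 0 < scale_f R c i.
Proof.
move=> ic; rewrite /scale_f ltr_wpDr ?ltr01 // mulr_ge0 //.
  by rewrite divr_ge0 ?subr_ge0 ?ler_nat.
by rewrite divr_ge0 // addr_ge0 ?mulr_ge0.
Qed.

(** On the boundary i = 0 the legs are k + 1 and j + 1 units of [raise_coef], which add up to the j
    + k + 2 of [scale_raise_coef]. *)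
Lemma series_leg s j k :
  leg s k.+1 0 j + leg s 0 j.+1 k
  = s * scale_f R (j + k).+2 (j + k).+1 * weight 0 j k.
Proof.
rewrite [leg s 0 _ _]legC !leg_raise (raise_coefC _ _ k).
by rewrite (scale_raise_coef s 0 j k); ring.
Qed.

(** The numerator of [Ystar] factors as v w m^2 (a + v + w) / a, so dividing by the first leg leaves
    a sum. *)
Lemma Ystar_product (a v w m : R) : a != 0 -> v != 0 -> w != 0 -> m != 0 ->
  Ystar (v * w / a * m) (v * m) (w * m) = (a + v + w) * m.
Proof. by move=> a0 v0 w0 m0; rewrite /Ystar; field; rewrite a0 v0 w0 m0. Qed.

Lemma star_leg s i j k : 0 < s ->
  Ystar (leg s j.+1 k.+1 i) (leg s k.+1 i.+1 j) (leg s i.+1 j.+1 k)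
  = s * scale_f R (i.+1 + j + k).+2 (i.+1 + j + k).+1
    * (weight i.+1 j k * (2 * i.+1%:R + 1)).
Proof.
move=> s0; rewrite [leg s i.+1 _ _]legC (leg_raise2 s i j k) !leg_raise.
rewrite (raise_coefC _ _ k) mulrA scale_raise_coef -(natr1 i).
have := ler0n R i; have := ler0n R j; have := ler0n R k.
have := raise_coef_gt0 s i.+1 j k s0.
move: (raise_coef _ _ _ _) i%:R j%:R k%:R => p x y z p0 z0 y0 x0.
(* Here a, v, w are i + 1, k + 1, j + 1; their sum i + j + k + 3 is the factor of [scale_raise_coef]
   at i + 1. *)
have := @Ystar_product (x + 1) (z + 1) (y + 1) ((2 * x + 3) * p).
rewrite !mulf_neq0 ?gt_eqF ?mulr_gt0 //; try lra.
move=> /(_ isT isT isT isT) E.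
transitivity ((x + 1 + (z + 1) + (y + 1)) * ((2 * x + 3) * p)); last by ring.
by rewrite -E; congr Ystar; ring.
Qed.

Lemma YstarC (u v w : R) : Ystar u v w = Ystar u w v.
Proof. by rewrite /Ystar; congr (_ / _); ring. Qed.

(* The left side of the child triangle (i, j, k) comes from the parent triangles
   (i, j.+1, k) and (i, j, k.+1), joined for 0 < i by (i.-1, j.+1, k.+1), which is
   opposite to it in the star; the right and base sides permute the roles. *)
Lemma row_reduction_homothetic s n T : 0 < s -> (0 < n)%N ->
  homothetic s n.+1 T -> homothetic (s * scale_f R n.+1 n) n (row_reduction T).
Proof.
move=> s0 n0 hT; split=> [|X r d dr rn]; first by rewrite /= hT.1.
have [i [j [k [en er ed]]]] :
    exists i j k, [/\ n = (i + j + k).+1, r = (i + j).+1 & d = i.+1].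
  by exists d.-1, (r - d)%N, (n - r)%N; split; lia.
subst n r d; clear n0 dr rn.
rewrite initial_label_weight.
have L i' j' k' : (i' + j' + k' = (i + j + k).+1)%N ->
    [/\ Y12 T (i' + j').+1 i'.+1 = leg s i' j' k',
        Y4 T (i' + j').+1 i'.+1 = leg s j' k' i'
      & Y8 T (i' + j').+1 i'.+1 = leg s k' i' j'].
  by move=> e; apply: legsE; rewrite ?e.
have hT1 := hT.1.
case: X => /=.
- have [|_ _ E8] := L i j k.+1; first lia.
  have [|] := L i j.+1 k; first lia.
  rewrite addnS => E12 _ _.
  case: i {hT} L hT1 E8 E12 => [|i] L hT1 E8 E12 /=.
    by rewrite E8 E12 series_leg add0n mulr0 add0r mulr1.
  have [|_] := L i j.+1 k.+1; first lia.
  by rewrite E8 E12 addnS -addSn => -> _; rewrite star_leg.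
- have [|_ E4 _] := L i j k.+1; first lia.
  have [|] := L i.+1 j k; first lia.
  rewrite addSn => E12 _ _.
  (* Rotating the coordinates to (j, k, i) reduces the right side to the formulas used for the left
     one; the base uses (k, i, j). *)
  have -> : (i + j + k = j + k + i)%N by lia.
  rewrite weight_rot; case: j {hT} L hT1 E4 E12 => [|j] L hT1 E4 E12 /=.
    rewrite addn0 in E4 E12 *.
    by rewrite eqxx E4 E12 addrC series_leg add0n mulr0 add0r mulr1.
  have [|_ _] := L i.+1 j k.+1; first lia.
  rewrite addSnnS => ->; rewrite E4 E12 YstarC star_leg // ifF //; lia.
- rewrite hT1; have [|_ + _] := L i j.+1 k; first lia.
  have [|_ _] := L i.+1 j k; first lia.
  rewrite addSn addnS => E8 E4.
  have -> : (i + j + k = k + i + j)%N by lia.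
  rewrite -(weight_rot k); case: k {hT} L hT1 E8 E4 => [|k] L hT1 E8 E4 /=.
    by rewrite add0n eqxx E4 E8 series_leg mulr0 add0r mulr1.
  have [|+ _ _] := L i.+1 j.+1 k; first lia.
  rewrite addSn addnS => ->; rewrite E8 E4 star_leg // ifF //; lia.
Qed.

End Barycentric.

Lemma homothetic_reduced_grid (R : realType) c i : (0 < i <= c)%N ->
  homothetic R (scale_f R c i) i (reduced_grid R c i).
Proof.
(* Writing i as c - (c - i) makes the number of reductions the induction variable. *)
case/andP=> i0 ic; rewrite -{1}(subKn ic) -{2}(subKn ic) /reduced_grid.
have : (c - i < c)%N by lia.
elim: (c - i)%N => [|k IH] kc /=.
  rewrite subn0; split=> // X r d _ _.
  by rewrite /scale_f subrr !mul0r addr0 mul1r.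
have e : (c - k = (c - k.+1).+1)%N by lia.
have n0 : (0 < c - k.+1)%N by lia.
(* Telescoping: with f(c, i) = g(i) / g(c), the middle term g(c - k) cancels. *)
have -> : scale_f R c (c - k.+1)
    = scale_f R c (c - k) * scale_f R (c - k.+1).+1 (c - k.+1).
  rewrite scale_f_succ // e /scale_f; move: n0; rewrite -(ltr_nat R) -(natr1 (c - k.+1)).
  have := ler0n R c; move: c%:R (c - k.+1)%:R => x y x0 y0.
  by field; rewrite !gt_eqF //; lra.
apply: row_reduction_homothetic => //; last by rewrite -e; apply: IH; lia.
by apply: scale_f_gt0; lia.
Qed.

(** The top triangle has coordinates (0, 0, i - 1), hence weight 1, so its leg is f(c, i) / (2i +
    1). *)
Lemma tail_reduced_grid (R : realType) c i : (0 < i <= c)%N ->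
  tail R c i = c%:R / (i%:R * (2 * c%:R + 1)).
Proof.
move=> ic; have h := homothetic_reduced_grid R c i ic.
case: i => [//|i] in ic h *.
have s0 : 0 < scale_f R c i.+1 by apply: scale_f_gt0; case/andP: ic.
rewrite /tail; have [-> _ _] := legsE R _ _ 0 0 i s0 h.
rewrite /leg weight0 /scale_f -(natr1 i).
have := ler0n R c; have := ler0n R i; move: c%:R i%:R => x y y0 x0.
by field; rewrite !gt_eqF //; lra.
Qed.

(** At a fixed order each relationship is homogeneous in the labels, so it passes from the initial
    grid to its multiples. *)
Lemma homothetic_edge_ratio (R : realType) s n (T : labelled_grid R) :
  homothetic R s n T -> edge_ratio_relationships T.
Proof.
case=> oT hT; have [_ [Ix Iy IR IB]] := initial_gridP R n.
rewrite /edge_ratio_relationships oT.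
split=> [r rn|r d dr rn|r d dr rn|r d dr rn].
- rewrite (hT Left r) ?(hT Left r.-1); [|lia..].
  by rewrite [RHS]mulrCA; congr (_ * _); apply: Ix.
- rewrite (hT Left r d) ?(hT Left r d.-1); [|lia..].
  by rewrite [RHS]mulrCA; congr (_ * _); apply: Iy.
- by rewrite !hT // [RHS]mulrCA; congr (_ * _); apply: IR.
- by rewrite !hT // [RHS]mulrCA; congr (_ * _); apply: IB.
Qed.

Theorem theorem4 (R : realType) (c : nat) (c_gt0 : (0 < c)%N) :
  [/\ (forall i : nat, (1 <= i <= c)%N -> tail R c i = 1 / i%:R * tail R c 1)
      /\ tail R c 1 = c%:R / (2 * c%:R + 1),
      forall i : nat, (1 <= i <= c)%N ->
        edge_ratio_relationships (reduced_grid R c i)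
    & forall i : nat, (1 <= i <= c - 1)%N ->
        forall (r d : nat) (X : side), (1 <= r <= i)%N -> (1 <= d <= r)%N ->
          reduced_grid R c i X r d
          = scale_f R c i * initial_grid R i X r d].
Proof.
have t1 : tail R c 1 = c%:R / (2 * c%:R + 1).
  by rewrite tail_reduced_grid ?c_gt0 // mul1r.
split=> [|i ic|i ic r d X ri dr].
- split=> // i ic; rewrite t1 tail_reduced_grid //.
  by rewrite invfM mulrCA mul1r.
- exact: homothetic_edge_ratio (homothetic_reduced_grid R c i ic).
- have ic' : (0 < i <= c)%N by lia.
  by have [_ ->] := homothetic_reduced_grid R c i ic' => //; case/andP: ri.
Qed.
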